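(* Let $\zeta_5=e^{2\pi i/5}$ and $$\mathbf M_{31}=\frac1{\sqrt5}\begin{pmatrix}1&1&1\\2&2\cos(2\pi/5)&2\cos(4\pi/5)\\2&2\cos(4\pi/5)&2\cos(2\pi/5)\end{pmatrix},\qquad \mathbf R_5=\operatorname{diag}(1,\zeta_5^2,\zeta_5^3).$$ Then $$\mathbf M_{31}^{\,2}=I,\qquad \mathbf R_5^{\,5}=I,\qquad(\mathbf M_{31}\mathbf R_5)^3=-I.$$ The subgroup of $\mathrm{GL}_3(\mathbb C)$ generated by $\mathbf M_{31}$ and $\mathbf R_5$ has order $120$ and is isomorphic to $A_5\times\{\pm I\}$, and both matrices preserve the quadratic form $x^2+yz$ on column vectors $(x,y,z)^{\mathsf T}\in\mathbb C^3$.
   Context: $I$ is the $3\times3$ identity matrix and $A_5$ is the alternating group on five letters. A matrix $M$ preserves $x^2+yz$ if $x'^2+y'z'=x^2+yz$ whenever $(x',y',z')^{\mathsf T}=M(x,y,z)^{\mathsf T}$. *)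

(* Defs.v *)
From mathcomp Require Import all_boot all_order all_algebra all_fingroup.
From mathcomp Require Import alt complex.
From mathcomp Require Import classical_sets functions cardinality reals.
From mathcomp Require Import sequences exp trigo.

Set Implicit Arguments.
Unset Strict Implicit.
Unset Printing Implicit Defensive.

Import Order.TTheory GRing.Theory Num.Theory.

Local Open Scope classical_set_scope.
Local Open Scope complex_scope.
Local Open Scope ring_scope.

(* C is R[i] for an arbitrary model R of the real numbers. The libraries have
   no complex exponential; it is defined here by
   exp (a + i b) = exp a * (cos b + i sin b). *)
Definition expC (R : realType) (z : R[i]) : R[i] :=
  (expR (complex.Re z))%:C * (cos (complex.Im z) +i* sin (complex.Im z)).

Definition zeta5 (R : realType) : R[i] := expC ((2 * pi)%:C * 'i%C / 5).

Definition M31 (R : realType) : 'M[R[i]]_3 :=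
  ((Num.sqrt 5 : R)%:C)^-1 *:
  \matrix_(i < 3, j < 3)
    (nth [::]
       [:: [:: 1; 1; 1];
           [:: 2; (2 * cos (2 * pi / 5))%:C; (2 * cos (4 * pi / 5))%:C];
           [:: 2; (2 * cos (4 * pi / 5))%:C; (2 * cos (2 * pi / 5))%:C]] i)`_j.

Definition R5 (R : realType) : 'M[R[i]]_3 :=
  diag_mx (\row_(j < 3) [:: 1; zeta5 R ^+ 2; zeta5 R ^+ 3]`_j).

Definition is_GL_subgroup (F : fieldType) (n : nat) (H : set 'M[F]_n) : Prop :=
  [/\ forall A, H A -> A \in unitmx,
      H 1%:M,
      forall A B, H A -> H B -> H (A *m B)
    & forall A, H A -> H (invmx A)].

(* For S contained in GL_n(F), the intersection of all subgroups of GL_n(F)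
   containing S. *)
Definition GL_generated (F : fieldType) (n : nat) (S : set 'M[F]_n) :
    set 'M[F]_n :=
  smallest (@is_GL_subgroup F n) S.

Definition pm1 (F : fieldType) (n : nat) : set 'M[F]_n :=
  [set 1%:M; - 1%:M].

Definition prod_op (T U : Type) (opT : T -> T -> T) (opU : U -> U -> U)
    (x y : T * U) : T * U :=
  (opT x.1 y.1, opU x.2 y.2).

(* Isomorphism of two groups given as subsets X and Y of types carrying the
   operations opT and opU. *)
Definition set_isog (T U : Type) (opT : T -> T -> T) (opU : U -> U -> U)
    (X : set T) (Y : set U) : Prop :=
  exists f : T -> U,
    set_bij X Y f /\
    forall x y, X x -> X y -> f (opT x y) = opU (f x) (f y).

Definition qform (F : fieldType) (v : 'cV[F]_3) : F :=
  v 0 0 ^+ 2 + v 1 0 * v 2 0.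

Definition preserves_qform (F : fieldType) (M : 'M[F]_3) : Prop :=
  forall v : 'cV[F]_3, qform (M *m v) = qform v.

(* Main.v *)
Require Import Defs.
From mathcomp Require Import all_boot all_order all_algebra all_fingroup.
From mathcomp Require Import alt complex finmap ring lra zify cyclic gseries.
From mathcomp Require Import classical_sets functions cardinality reals.
From mathcomp Require Import boolp exp trigo.

(** The twenty vertices of a regular dodecahedron are indexed by the ordered
    pairs of distinct elements of Z/5 (five inscribed tetrahedra), with opposite
    vertices given by [(i, j)] and [(j, i)].  Both [- M31] and [R5] permute them
    through permutations of Z/5: [(1 2)(3 4)] and the translation [i |-> i - 1].
    The vertices are distinct and span the space, so a matrix acting on them
    through a permutation determines it and is determined by it.  The relations
    can thus be read off the permutations, and sending [A] to the unique pair
    [(s, e)] such that [e A] acts through [s] is an injective morphism.  It is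
    onto because the two permutations generate a subgroup of the simple group
    A_5 of order divisible by 2, 3 and 5, hence A_5 itself. *)

Set Implicit Arguments.
Unset Strict Implicit.
Unset Printing Implicit Defensive.

Import Order.TTheory GRing.Theory Num.Theory.

Local Open Scope classical_set_scope.
Local Open Scope ring_scope.

(** * Two permutations generating A_5 *)

Definition perm_matM : 'S_5 := (tperm (1%R : 'I_5) 2%R * tperm (3%R : 'I_5) 4%R)%g.
Definition perm_matP : 'S_5 := perm (addIr (-1 : 'I_5)).

Lemma perm_matME (i : 'I_5) : perm_matM i = nth 0 [:: 0; 2; 1; 4; 3] i.
Proof.
by case: i => [[|[|[|[|[|//]]]]] hi]; apply/val_inj; rewrite permM !permE /=.
Qed.

Lemma perm_matPE i : perm_matP i = i - 1.
Proof. exact: permE. Qed.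

Lemma perm_matM_sqr : (perm_matM ^+ 2 = 1)%g.
Proof.
apply/permP=> i; rewrite expgS expg1 permM perm1 !perm_matME.
by case: i => [[|[|[|[|[|//]]]]] hi]; apply/val_inj.
Qed.

Lemma perm_matP_expr5 : (perm_matP ^+ 5 = 1)%g.
Proof.
apply/permP=> i; rewrite !expgS expg0 mulg1 !permM perm1 !perm_matPE.
by case: i => [[|[|[|[|[|//]]]]] hi]; apply/val_inj.
Qed.

Lemma perm_matMP_expr3 : ((perm_matM * perm_matP) ^+ 3 = 1)%g.
Proof.
have: forall i, (perm_matM * perm_matP)%g i = [:: 0; 2; 1; 4; 3]`_i - 1.
  by move=> i; rewrite permM perm_matPE perm_matME.
move: (_ * _)%g => s sE; apply/permP=> i.
rewrite !expgS expg0 mulg1 !permM perm1 !sE.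
by case: i => [[|[|[|[|[|//]]]]] hi]; apply/val_inj.
Qed.

Lemma perm_matM_Alt : perm_matM \in Alt 'I_5.
Proof. by rewrite Alt_even odd_permM !odd_tperm. Qed.

Lemma perm_matP_Alt : perm_matP \in Alt 'I_5.
Proof.
rewrite Alt_even; have := congr1 (@odd_perm _) perm_matP_expr5.
by rewrite !expgS expg0 mulg1 !odd_permM odd_perm1; case: odd_perm.
Qed.

Lemma card_Alt5 : #|Alt 'I_5| = 60.
Proof. by apply: double_inj; rewrite -mul2n card_Alt card_ord. Qed.

Lemma gen_Alt5 (H : {group 'S_5}) :
  H \subset Alt 'I_5 -> perm_matM \in H -> perm_matP \in H -> H :=: Alt 'I_5.
Proof.
move=> sHA MH PH.
have ord p (s : 'S_5) i :
    prime p -> s \in H -> (s ^+ p = 1)%g -> s i != i -> (p %| #|H|)%N.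
  move=> p_pr sH s1 si; rewrite -(nt_prime_order p_pr s1) ?order_dvdG //.
  by apply: contraNneq si => ->; rewrite perm1.
have o2 : (2 %| #|H|)%N.
  by apply: (ord _ _ 1 _ MH perm_matM_sqr) => //; rewrite perm_matME.
have o3 : (3 %| #|H|)%N.
  apply: (ord _ _ 0 _ (groupM MH PH) perm_matMP_expr3) => //.
  by rewrite permM perm_matME perm_matPE.
have o5 : (5 %| #|H|)%N.
  by apply: (ord _ _ 0 _ PH perm_matP_expr5) => //; rewrite permE.
have o30 : (30 %| #|H|)%N.
  by rewrite (@Gauss_dvd 6 5) // o5 (@Gauss_dvd 2 3) // o2 o3.
have oH0 := cardG_gt0 H.
(* Since 30 divides the order of [H], the index is 1 or 2. Index 2 makes [H] normal, and simplicity
   then leaves only the trivial group, whose order is odd, or A_5. *)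
have := Lagrange sHA; rewrite card_Alt5.
case/dvdnP: o30 oH0 => m -> m0 /eqP.
have [i2|i2 oE] := eqVneq #|Alt 'I_5 : H|%g 2%N.
  move=> _; have /simpleP[_ /(_ _ (index2_normal sHA i2))[H1|//]] : simple (Alt 'I_5).
    by apply: simple_Alt5; rewrite card_ord.
  by have := o2; rewrite H1 cards1.
apply/eqP; rewrite finset.eqEsubset sHA /= -indexg_eq1.
move: oE i2; case: #|_ : _|%g => [|[|[|n]]] //; first by rewrite muln0.
by case: m m0 => [//|m] _; rewrite !mulSn mulnS; lia.
Qed.

Lemma qformZ (F : fieldType) (c : F) (v : 'cV[F]_3) :
  qform (c *: v) = c ^+ 2 * qform v.
Proof. by rewrite /qform !mxE; ring. Qed.

(** * Vertices of the dodecahedron and the two matrices acting on them *)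

Section Dodecahedron.

Variables (F : numFieldType) (z : F).
Hypothesis z_prim : 5.-primitive_root z.

(** The fifth cyclotomic relation, oriented so that [ring] can reduce polynomials in [z] to degree
    at most 3. *)
Lemma prim5_expr4 : z ^+ 4 = - (1 + z + z ^+ 2 + z ^+ 3).
Proof.
have z1 : z - 1 != 0.
  by rewrite subr_eq0 -[z]expr1 -(prim_order_dvd z_prim).
apply: (mulfI z1); have := prim_expr_order z_prim.
by move=> z5; ring: z5.
Qed.

(* The entries span a three-dimensional summand of the exterior square of the
   permutation representation: with a = z^i and b = z^j the entries are
   combinations of the antisymmetric functions z^(ki + lj) - z^(li + kj) with
   k + l = 0, 2 and 3 modulo 5, the weights of the diagonal of [matP]. *)
Definition vertex (a b : F) : 'cV[F]_3 :=
  \col_(k < 3) [:: a ^+ 4 * b - a * b ^+ 4 + a ^+ 3 * b ^+ 2 - a ^+ 2 * b ^+ 3;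
                   2 * a ^+ 3 * b ^+ 3 * (b - a);
                   2 * a * b * (b - a)]`_k.

Definition vtx (i j : 'I_5) := vertex (z ^+ i) (z ^+ j).

Lemma vertexN a b : vertex b a = - vertex a b.
Proof.
by apply/matrixP=> -[[|[|[|//]]] hk] l; rewrite !mxE /=; ring.
Qed.

(** The ratio of the last two coordinates is (ab)^2, which determines ab because (ab)^5 = 1; the
    last coordinate then gives b - a. So a and -b are the roots of a known quadratic, leaving a = c
    or a = -d, and the latter fails because (-d)^5 = -1. *)
Lemma vertex_inj a b c d :
  a ^+ 5 = 1 -> b ^+ 5 = 1 -> c ^+ 5 = 1 -> d ^+ 5 = 1 -> a != b ->
  vertex a b = vertex c d -> a = c /\ b = d.
Proof.
move=> a5 b5 c5 d5 ab E.
have n2 : (2 : F) != 0 by rewrite pnatr_eq0.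
have nz (x : F) : x ^+ 5 = 1 -> x != 0.
  by move=> x5; apply/eqP=> x0; have := oner_neq0 F; rewrite -x5 x0 expr0n eqxx.
have /matrixP /(_ 1 0) := E; have /matrixP /(_ 2 0) := E; rewrite !mxE /= => w y.
have y' : 2 * a * b * (b - a) * (a * b) ^+ 2 = 2 * a * b * (b - a) * (c * d) ^+ 2.
  rewrite [in RHS]w; transitivity (2 * a ^+ 3 * b ^+ 3 * (b - a)); first by ring.
  by rewrite y; ring.
have w0 : 2 * a * b * (b - a) != 0.
  by apply: mulf_neq0; [rewrite !mulf_neq0 // nz | rewrite subr_eq0 eq_sym].
have p2 := mulfI w0 y'.
have p : a * b = c * d.
  have e6 (u v : F) : u ^+ 5 = 1 -> v ^+ 5 = 1 -> u * v = ((u * v) ^+ 2) ^+ 3.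
    by move=> u5 v5; ring: u5 v5.
  by rewrite (e6 a b) // p2 -e6.
have q : b - a = d - c.
  apply: (mulfI (x := 2 * (a * b))); first by rewrite !mulf_neq0 // nz.
  by rewrite {2}p !mulrA.
have : (a - c) * (a + d) == 0.
  have -> : (a - c) * (a + d) = a * (a + (d - c)) - c * d by ring.
  by rewrite -q subrKC p subrr.
rewrite mulf_eq0 subr_eq0 => /orP[/eqP ac|].
  by split=> //; move: q; rewrite ac => /addIr.
rewrite addr_eq0 => /eqP ad; have := a5; rewrite ad exprNn d5 mulr1.
by rewrite -signr_odd expr1 => /eqP; rewrite eq_sym -subr_eq0 opprK (pnatr_eq0 F 2).
Qed.

(** The quadratic Gauss sum z - z^2 - z^3 + z^4, a square root of 5 in [F]. *)
Definition root5 : F := 1 + 2 * (z + z ^+ 4).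

Definition matM : 'M[F]_3 :=
  root5^-1 *:
  \matrix_(i < 3, j < 3)
    (nth [::] [:: [:: 1; 1; 1];
                  [:: 2; z + z ^+ 4; z ^+ 2 + z ^+ 3];
                  [:: 2; z ^+ 2 + z ^+ 3; z + z ^+ 4]] i)`_j.

Definition matP : 'M[F]_3 := diag_mx (\row_(j < 3) [:: 1; z ^+ 2; z ^+ 3]`_j).

(* Oriented so that the product of matrices corresponds to the product of
   permutations, which composes from left to right. *)
Definition acts (A : 'M[F]_3) (s : 'S_5) :=
  forall i j, A *m vtx (s i) (s j) = vtx i j.

Lemma root5_sqr : root5 ^+ 2 = 5.
Proof. by have z4 := prim5_expr4; rewrite /root5; ring: z4. Qed.

Lemma root5_neq0 : root5 != 0.
Proof. by rewrite -sqrf_eq0 root5_sqr pnatr_eq0. Qed.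

(** The coordinates of [vertex] are homogeneous of degrees 5, 7 and 3, so scaling both arguments by
    [z] multiplies them by 1, z^2 and z^3. *)
Lemma acts_matP : acts matP perm_matP.
Proof.
have z5 := prim_expr_order z_prim.
move=> i j.
have zE (k : 'I_5) : z ^+ k = z * z ^+ perm_matP k.
  by case: k => [[|[|[|[|[|//]]]]] hk]; rewrite permE /= -exprS ?z5.
rewrite /vtx (zE i) (zE j).
apply/matrixP=> -[[|[|[|//]]] hk] l; rewrite mul_diag_mx !mxE /=; ring: z5.
Qed.

Lemma acts_matM : acts (- matM) perm_matM.
Proof.
have z4 := prim5_expr4.
(* Clearing the denominator leaves polynomial identities in [z], checked for each of the 25 index
   pairs. *)
move=> i j; apply: (scalerI root5_neq0).
rewrite scalemxAl scalerN scalerA mulfV ?root5_neq0 // scale1r /vtx !perm_matME.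
case: i j => [[|[|[|[|[|//]]]]] hi] [[|[|[|[|[|//]]]]] hj] /=;
  apply/matrixP=> -[[|[|[|//]]] hk] l;
  rewrite !mxE !big_ord_recl big_ord0 !mxE /= /root5; ring: z4.
Qed.

Lemma vtx_inj i j k l : i != j -> vtx i j = vtx k l -> i = k /\ j = l.
Proof.
have z5 := prim_expr_order z_prim.
have zX (m : 'I_5) : (z ^+ m) ^+ 5 = 1 by rewrite exprAC z5 expr1n.
have zI (m n : 'I_5) : z ^+ m = z ^+ n -> m = n.
  move/eqP; rewrite (eq_prim_root_expr z_prim) !modn_small // => /eqP.
  exact: val_inj.
move=> ij /vertex_inj [//|//|//|//||/zI ik /zI jl] //.
by apply: contra ij => /eqP /zI ->.
Qed.

Lemma mulmx_vtx_eq0 (A : 'M[F]_3) : (forall i j, A *m vtx i j = 0) -> A = 0.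
Proof.
move=> A0; apply/matrixP=> k l; rewrite [RHS]mxE.
have z4 := prim5_expr4.
pose g m n := (A *m vertex (z ^+ m) (z ^+ n)) k 0.
have g0 m n : (m < 5)%N -> (n < 5)%N -> g m n = 0.
  by move=> hm hn; rewrite /g (A0 (Ordinal hm) (Ordinal hn)) mxE.
have n0 n : (n.+1%:R : F) != 0 by rewrite pnatr_eq0.
have gE m n : g m n = A k 0 * vertex (z ^+ m) (z ^+ n) 0 0 +
    A k 1 * vertex (z ^+ m) (z ^+ n) 1 0 + A k 2%R * vertex (z ^+ m) (z ^+ n) 2%R 0.
  by rewrite /g mxE !big_ord_recl big_ord0 addr0 addrA; do !f_equal; apply: val_inj.
(* Each row coordinate is isolated by a Fourier sum over the orbit of a
   vertex under [matP]. *)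
case: l => [[|[|[|//]]] hl].
- rewrite (_ : Ordinal hl = 0); last exact: val_inj.
  (* The factor before each Fourier sum turns the relevant coordinate of [vertex 1 z] into 5 here
     and into 10 in the next two cases. Five equal terms give 25 and 50, the successors of the
     arguments of [n0]. *)
  apply: (mulfI (n0 24%N)); rewrite mulr0.
  transitivity ((z ^+ 2 - z ^+ 3 - z + z ^+ 4) * (1 + 2 * (z + z ^+ 4)) *
     (g 0%N 1%N + g 1%N 2%N + g 2%N 3%N + g 3%N 4%N + g 4%N 0%N)).
    by rewrite !gE !mxE /=; ring: z4.
  by rewrite !g0 // !addr0 mulr0.
- rewrite (_ : Ordinal hl = 1); last exact: val_inj.
  apply: (mulfI (n0 49%N)); rewrite mulr0.
  transitivity (- z ^+ 2 * (4 + 3 * z + 2 * z ^+ 2 + z ^+ 3) *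
     (g 0%N 1%N + z ^+ 3 * g 1%N 2%N + z * g 2%N 3%N + z ^+ 4 * g 3%N 4%N +
      z ^+ 2 * g 4%N 0%N)).
    by rewrite !gE !mxE /=; ring: z4.
  by rewrite !g0 // !mulr0 !addr0 mulr0.
- rewrite (_ : Ordinal hl = 2%R); last exact: val_inj.
  apply: (mulfI (n0 49%N)); rewrite mulr0.
  transitivity (- z ^+ 4 * (4 + 3 * z + 2 * z ^+ 2 + z ^+ 3) *
     (g 0%N 1%N + z ^+ 2 * g 1%N 2%N + z ^+ 4 * g 2%N 3%N + z * g 3%N 4%N +
      z ^+ 3 * g 4%N 0%N)).
    by rewrite !gE !mxE /=; ring: z4.
  by rewrite !g0 // !mulr0 !addr0 mulr0.
Qed.

(** * Correspondence between matrices and permutations *)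

Lemma vtxN i j : vtx j i = - vtx i j.
Proof. exact: vertexN. Qed.

Lemma acts1 : acts 1%:M 1.
Proof. by move=> i j; rewrite mul1mx !perm1. Qed.

Lemma actsM A B s t : acts A s -> acts B t -> acts (A *m B) (s * t).
Proof. by move=> As Bt i j; rewrite -mulmxA !permM Bt As. Qed.

Lemma actsV A s i j : acts A s -> A *m vtx i j = vtx (s^-1%g i) (s^-1%g j).
Proof. by move=> As; have := As (s^-1%g i) (s^-1%g j); rewrite !permKV. Qed.

Lemma acts_perm_inj A s t : acts A s -> acts A t -> s = t.
Proof.
move=> As At; apply/invg_inj/permP=> i.
have [j ij] : exists j : 'I_5, i != j.
  by exists (i + 1); rewrite eq_sym -subr_eq0 addrAC subrr add0r.
have E : vtx (s^-1%g i) (s^-1%g j) = vtx (t^-1%g i) (t^-1%g j).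
  by rewrite -(actsV _ _ As) (actsV _ _ At).
by have [] := vtx_inj _ E; rewrite ?(inj_eq perm_inj).
Qed.

(** Negation swaps the two indices of a vertex, so [s^-1 i = t^-1 j] would hold for all distinct [i]
    and [j], forcing [s^-1] to take equal values at 0 and 1. *)
Lemma actsN A s t : acts A s -> ~ acts (- A) t.
Proof.
move=> As At.
have E (i j : 'I_5) : i != j -> s^-1%g i = t^-1%g j.
  move=> ij; apply: (proj1 (@vtx_inj _ (s^-1%g j) _ (t^-1%g i) _ _)).
    by rewrite (inj_eq perm_inj).
  by rewrite -(actsV _ _ As) [RHS]vtxN -(actsV _ _ At) mulNmx opprK.
by have := E 0 2%R isT; rewrite -(E 1 2%R isT) => /perm_inj.
Qed.

Lemma acts_mx_inj A B s : acts A s -> acts B s -> A = B.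
Proof.
move=> As Bs; apply/eqP; rewrite -subr_eq0; apply/eqP/mulmx_vtx_eq0 => i j.
by rewrite mulmxBl (actsV _ _ As) (actsV _ _ Bs) subrr.
Qed.

Lemma actsX A s n : acts A s -> acts (A ^+ n) (s ^+ n)%g.
Proof.
move=> As; elim: n => [|n IHn]; first exact: acts1.
by rewrite exprS expgS; exact: actsM.
Qed.

Lemma acts_expr_eq1 A s n : acts A s -> (s ^+ n = 1)%g -> A ^+ n = 1.
Proof. by move=> /actsX-/(_ n) As s1; apply: acts_mx_inj acts1; rewrite -s1. Qed.

(** * Relations and the invariant quadratic form *)

Lemma matM_sqr : matM ^+ 2 = 1.
Proof. by rewrite -sqrrN (acts_expr_eq1 acts_matM perm_matM_sqr). Qed.

Lemma matP_expr5 : matP ^+ 5 = 1.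
Proof. exact: acts_expr_eq1 acts_matP perm_matP_expr5. Qed.

Lemma matMP_expr3 : (matM *m matP) ^+ 3 = - 1.
Proof.
have := acts_expr_eq1 (actsM acts_matM acts_matP) perm_matMP_expr3.
by rewrite mulNmx exprNn -signr_odd expr1 mulN1r => <-; rewrite opprK.
Qed.

Lemma matM_qform : preserves_qform matM.
Proof.
have z4 := prim5_expr4.
have n5 : (5 : F) != 0 by rewrite pnatr_eq0.
move=> v; rewrite /matM -scalemxAl qformZ exprVn root5_sqr.
apply: (mulfI n5); rewrite mulVKf // /qform !mxE !big_ord_recl !big_ord0 !mxE /=.
rewrite (_ : lift ord0 (lift ord0 ord0) = 2%R); last exact: val_inj.
rewrite (_ : lift ord0 ord0 = 1); last exact: val_inj.
ring: z4.
Qed.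

Lemma matP_qform : preserves_qform matP.
Proof.
have z5 := prim_expr_order z_prim.
by move=> v; rewrite /qform /matP mul_diag_mx !mxE /=; ring: z5.
Qed.

(** * The generated group and its isomorphism with A_5 x {1, -1} *)

Definition signed_acts (A : 'M[F]_3) (p : 'S_5 * 'M[F]_3) :=
  ([set s | s \in Alt 'I_5] `*` @pm1 F 3) p /\ acts (p.2 *m A) p.1.

Lemma pm1_sqr (e : 'M[F]_3) : pm1 e -> e *m e = 1%:M.
Proof. by case=> ->; rewrite ?mulNmx mul1mx ?opprK. Qed.

Lemma pm1_comm (e A : 'M[F]_3) : pm1 e -> e *m A = A *m e.
Proof. by case=> ->; rewrite ?mulNmx ?mulmxN mul1mx mulmx1. Qed.

Lemma pm1M (e f : 'M[F]_3) : pm1 e -> pm1 f -> pm1 (e *m f).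
Proof.
by move=> [->|->] [->|->]; rewrite ?mulNmx ?mul1mx ?opprK;
  [left|right|right|left].
Qed.

Lemma signed_actsM A B p q : signed_acts A p -> signed_acts B q ->
  signed_acts (A *m B) (prod_op (fun s t => s * t)%g (@mulmx F 3 3 3) p q).
Proof.
move=> [[/= p1 p2] Ap] [[/= q1 q2] Bq]; split; first by split; [exact: groupM|exact: pm1M].
have -> : p.2 *m q.2 *m (A *m B) = (p.2 *m A) *m (q.2 *m B).
  by rewrite -!mulmxA [q.2 *m (A *m B)]mulmxA (pm1_comm A q2) -!mulmxA.
exact: actsM.
Qed.

Lemma signed_acts_inj A p q : signed_acts A p -> signed_acts A q -> p = q.
Proof.
case: p q => [s e] [t f] [[/= _ pe] As] [[/= _ pf] At].
have ef : e = f.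
  case: pe As => ->; case: pf At => -> //; rewrite mulNmx !mul1mx => At As.
  - by case: (actsN As At).
  - by case: (actsN At As).
by rewrite ef in As *; rewrite (acts_perm_inj As At).
Qed.

Lemma signed_acts_mx_inj A B p : signed_acts A p -> signed_acts B p -> A = B.
Proof.
move=> [[/= _ /pm1_sqr p2] Ap] [_ Bp].
by rewrite -[A]mul1mx -[B]mul1mx -p2 -!mulmxA (acts_mx_inj Ap Bp).
Qed.

Lemma matM_unit : matM \in unitmx.
Proof. by have := matM_sqr; rewrite expr2 => /mulmx1_unit[]. Qed.

Lemma matP_unit : matP \in unitmx.
Proof. by have := matP_expr5; rewrite exprS => /mulmx1_unit[]. Qed.

Lemma signed_acts_matM : signed_acts matM (perm_matM, - 1%:M).
Proof.
split; first by split; [exact: perm_matM_Alt|right].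
by rewrite mulNmx mul1mx; exact: acts_matM.
Qed.

Lemma signed_acts_matP : signed_acts matP (perm_matP, 1%:M).
Proof.
split; first by split; [exact: perm_matP_Alt|left].
by rewrite mul1mx; exact: acts_matP.
Qed.

Local Notation G := (GL_generated [set matM; matP]).

(** Invertible matrices with a signed action form a subgroup containing both generators, so it
    contains the smallest such subgroup. *)
Lemma gen_signed_acts A : G A -> exists p, signed_acts A p.
Proof.
suff : G `<=` [set A | A \in unitmx /\ exists p, signed_acts A p].
  by move=> + GA => /(_ _ GA)[].
apply: smallest_sub; last first.
  move=> _ [->|->]; split; [exact: matM_unit| |exact: matP_unit|].
  - by exists (perm_matM, - 1%:M); exact: signed_acts_matM.
  - by exists (perm_matP, 1%:M); exact: signed_acts_matP.
split=> [B []//||B C [uB [p Bp]] [uC [q Cq]]|B [uB [p [[/= p1 p2] Bp]]]].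
- split; first exact: unitmx1.
  exists (1%g, 1%:M); split; first by split; [exact: group1|left].
  by rewrite mul1mx; exact: acts1.
- by split; [rewrite unitmx_mul uB|eexists; exact: signed_actsM Bp Cq].
split; first by rewrite unitmx_inv.
exists ((p.1^-1)%g, p.2); split; first by split; [rewrite /= groupV|].
move=> i j; rewrite -(actsV _ _ Bp) mulmxA (pm1_comm _ p2) -!mulmxA.
by rewrite (mulmxA p.2 p.2) (pm1_sqr p2) mul1mx mulmxA mulVmx // mul1mx.
Qed.

Lemma genM A B : G A -> G B -> G (A *m B).
Proof. move=> GA GB H [HG sH]; case: (HG) => _ _ HM _.
by apply: HM; [exact: GA|exact: GB]. Qed.

Lemma gen_matM : G matM.
Proof. by move=> H [_ sH]; apply: sH; left. Qed.

Lemma gen_matP : G matP.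
Proof. by move=> H [_ sH]; apply: sH; right. Qed.

(** The cube of [matM *m matP] supplies [- 1%:M], so signs can be adjusted inside the group. *)
Lemma gen_pm1 : @pm1 F 3 `<=` G.
Proof.
move=> e [->|->]; first by move=> H [[]].
have := matMP_expr3; rewrite exprS expr2 => <-.
by do !apply: genM; (exact: gen_matM || exact: gen_matP).
Qed.

Lemma gen_signed_acts_surj p :
  ([set s | s \in Alt 'I_5] `*` @pm1 F 3) p -> exists2 A, G A & signed_acts A p.
Proof.
case: p => s e [/= sAlt pe].
(* The even permutations realized without sign by elements of [G]. They form a subgroup containing
   both generating permutations, since [- matM] lies in [G]; the sign [e] is restored at the end. *)
pose H := [set t | (t \in Alt 'I_5) && `[< exists2 A, G A & acts A t >]]%SET.
have inH t : t \in H = (t \in Alt 'I_5) && `[< exists2 A, G A & acts A t >].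
  by rewrite finset.in_set.
have gH : group_set H.
  apply/group_setP; split.
    rewrite inH group1; apply/asboolP; exists 1%:M; last exact: acts1.
    by apply: gen_pm1; left.
  move=> t u; rewrite !inH => /andP[t5 /asboolP[A GA At]] /andP[u5 /asboolP[B GB Bu]].
  by rewrite groupM //; apply/asboolP; exists (A *m B); [exact: genM|exact: actsM].
have HA : H = Alt 'I_5.
  apply: (gen_Alt5 (H := Group gH)).
  - by apply/fintype.subsetP => t; rewrite inH => /andP[].
  - rewrite inH perm_matM_Alt; apply/asboolP; exists (- 1%:M *m matM).
      by apply: genM gen_matM; apply: gen_pm1; right.
    by rewrite mulNmx mul1mx; exact: acts_matM.
  - rewrite inH perm_matP_Alt; apply/asboolP.
    by exists matP; [exact: gen_matP|exact: acts_matP].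
move: (sAlt); rewrite -HA inH => /andP[_ /asboolP[A GA As]].
exists (e *m A); first by apply: genM GA; exact: gen_pm1.
by split=> //=; rewrite mulmxA pm1_sqr // mul1mx.
Qed.

Lemma gen_isog : exists f : 'M[F]_3 -> 'S_5 * 'M[F]_3,
  set_bij G ([set s | s \in Alt 'I_5] `*` @pm1 F 3) f /\
  forall A B, G A -> G B ->
    f (A *m B) = prod_op (fun s t => s * t)%g (@mulmx F 3 3 3) (f A) (f B).
Proof.
(* On [G] a pair exists by [gen_signed_acts], so [xget] returns such a pair, not the default. *)
pose f A := xget (1%g, 1%:M) (signed_acts A).
have fP A : G A -> signed_acts A (f A).
  by move=> /gen_signed_acts[p Ap]; exact: (xgetPex _ (ex_intro _ p Ap)).
exists f; split; last first.
  move=> A B GA GB; apply: (signed_acts_inj (fP _ (genM GA GB))).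
  exact: signed_actsM (fP _ GA) (fP _ GB).
split=> [A /fP[]|A B|p /gen_signed_acts_surj[A GA Ap]].
- by [].
- rewrite !inE => GA GB fAB; apply: signed_acts_mx_inj (fP _ GA) _.
  by rewrite fAB; exact: fP.
- by exists A => //; exact: signed_acts_inj (fP _ GA) Ap.
Qed.

Lemma card_Alt5_pm1 : ([set s | s \in Alt 'I_5] `*` @pm1 F 3 #= `I_120)%card.
Proof.
pose l := [seq (s, e) | s <- enum (Alt 'I_5), e <- [:: 1%:M; - 1%:M : 'M[F]_3]].
have n1 : (1%:M : 'M[F]_3) != - 1%:M.
  apply/eqP=> /matrixP/(_ 0 0); rewrite !mxE /= => /eqP.
  by rewrite -addr_eq0 (pnatr_eq0 F 2).
have ul : uniq l.
  by apply: allpairs_uniq => [||[? ?] [? ?] _ _ //]; rewrite ?enum_uniq //= inE n1.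
have -> : [set s | s \in Alt 'I_5] `*` @pm1 F 3 = [set` [fset p in l]%fset].
  apply/seteqP; split=> -[s e] /=; rewrite in_fset_ /=.
    case=> /= s5 pe; apply/allpairsP; exists (s, e); split=> //=; first by rewrite mem_enum.
    by case: pe => ->; rewrite !inE ?eqxx ?orbT.
  case/allpairsP=> -[t f] /= [t5 fe [st ef]]; split=> /=; first by rewrite st -mem_enum.
  by move: fe; rewrite !inE -ef => /orP[] /eqP ->; [left|right].
apply/card_eq_fsetP; rewrite card_fseq undup_id // size_allpairs -cardE.
by rewrite (_ : #|_| = 60) //; exact: card_Alt5.
Qed.

End Dodecahedron.

(** * The complex fifth root of unity and its cosines *)

Section FifthRootOfUnity.

Variable R : realType.

Lemma zeta5E : zeta5 R = Complex (cos (2 * pi / 5)) (sin (2 * pi / 5)).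
Proof.
rewrite /zeta5 mulrAC -(rmorph_nat (real_complex R)) -fmorphV -rmorphM /expC /=.
by rewrite !(mulr0, mul0r, mulr1, subr0, addr0) expR0 mul1r.
Qed.

Lemma exprC_cis (x : R) n :
  Complex (cos x) (sin x) ^+ n = Complex (cos (x *+ n)) (sin (x *+ n)).
Proof.
elim: n => [|n IHn]; first by rewrite !mulr0n cos0 sin0.
rewrite exprS IHn mulrS cosD sinD; apply/eqP; rewrite eq_complex /= eqxx /=.
by rewrite addrC.
Qed.

Lemma zeta5_prim : 5.-primitive_root (zeta5 R).
Proof.
have z5 : zeta5 R ^+ 5 = 1.
  have E : (2 * pi / 5) *+ 5 = pi *+ 2 :> R by field.
  by rewrite zeta5E exprC_cis E cos2pi sin2pi.
(* The imaginary part sin(2 pi / 5) is positive; as 5 is prime, the order must then be 5. *)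
have z1 : zeta5 R != 1.
  rewrite zeta5E eq_complex negb_and /= orbC gt_eqF // sin_gt0_pi //.
  by have := pi_gt0 R; lra.
have [m m_prim] := prim_order_exists (isT : 0 < 5)%N z5.
case/primeP: (isT : prime 5) => _ dvd5 /dvd5 /orP[] /eqP m5; last by rewrite -m5.
by move: z1; rewrite -[zeta5 R]expr1 -m5 prim_expr_order ?eqxx.
Qed.

Lemma zeta5J : (zeta5 R)^*%C = zeta5 R ^+ 4.
Proof.
have z5 := prim_expr_order zeta5_prim.
have z0 : zeta5 R != 0.
  by apply/eqP=> z0; move/eqP: z5; rewrite z0 expr0n eq_sym oner_eq0.
apply: (mulfI z0); rewrite -exprS z5 zeta5E /=; move: (2 * pi / 5) => x; apply/eqP.
rewrite eq_complex /= -(cos2Dsin2 x) mulrN opprK !expr2 eqxx /=.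
by rewrite mulrN mulrC addNr.
Qed.

Lemma zeta5D4 : zeta5 R + zeta5 R ^+ 4 = (2 * cos (2 * pi / 5))%:C%C.
Proof. by rewrite -zeta5J addcJ zeta5E /= rmorphM rmorph_nat. Qed.

Lemma zeta5_2D3 : zeta5 R ^+ 2 + zeta5 R ^+ 3 = (2 * cos (4 * pi / 5))%:C%C.
Proof.
have z5 := prim_expr_order zeta5_prim.
have -> : zeta5 R ^+ 3 = (zeta5 R ^+ 2)^*%C.
  by rewrite rmorphXn [X in _ = X ^+ 2]zeta5J; ring: z5.
rewrite addcJ {1}zeta5E exprC_cis /= rmorphM rmorph_nat.
by have -> : (2 * pi / 5) *+ 2 = 4 * pi / 5 :> R by field.
Qed.

(** The Gauss sum fixes the square of 1 + 4 cos(2 pi / 5); its sign comes from 2 pi / 5 < pi / 2,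
    which makes the cosine positive. *)
Lemma sqrt5E : (Num.sqrt 5)%:C%C = root5 (zeta5 R).
Proof.
set c := cos (2 * pi / 5 : R).
have r5 : root5 (zeta5 R) = (1 + 4 * c)%:C%C.
  rewrite /root5 zeta5D4 rmorphD rmorph1 !rmorphM !rmorph_nat /= -/c; ring.
have : (1 + 4 * c) ^+ 2 = 5.
  apply: complexI; rewrite rmorphXn [X in X ^+ 2](esym r5) rmorph_nat.
  exact: root5_sqr zeta5_prim.
rewrite r5 => <-; rewrite sqrtr_sqr ger0_norm // addr_ge0 // mulr_ge0 // ltW //.
by apply: cos_gt0_pihalf; have := pi_gt0 R; lra.
Qed.

Lemma M31E : M31 R = matM (zeta5 R).
Proof. by rewrite /M31 /matM sqrt5E zeta5D4 zeta5_2D3. Qed.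

Lemma R5E : R5 R = matP (zeta5 R).
Proof. by []. Qed.

End FifthRootOfUnity.

Theorem proposition7p2 (R : realType) :
  let M : 'M[R[i]%C]_3 := M31 R in
  let P : 'M[R[i]%C]_3 := R5 R in
  let G : set 'M[R[i]%C]_3 := GL_generated [set M; P] in
  [/\ M ^+ 2 = 1%:M, P ^+ 5 = 1%:M & (M *m P) ^+ 3 = - 1%:M] /\
  [/\ M \in unitmx, P \in unitmx,
      (G #= `I_120)%card
    & set_isog (@mulmx R[i]%C 3 3 3)
        (prod_op (fun s t : {perm 'I_5} => (s * t)%g) (@mulmx R[i]%C 3 3 3))
        G ([set s | s \in Alt 'I_5] `*` @pm1 R[i]%C 3)] /\
  (preserves_qform M /\ preserves_qform P).
Proof.
have z_prim := zeta5_prim R; rewrite M31E R5E => M P G.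
have [f [fbij fM]] := gen_isog z_prim.
split; first by split; [exact: matM_sqr|exact: matP_expr5|exact: matMP_expr3].
split; last by split; [exact: matM_qform|exact: matP_qform].
split; [exact: matM_unit|exact: matP_unit| |by exists f].
apply: card_eq_trans (card_Alt5_pm1 _).
have [g] := proj2 bijPex (ex_intro _ f fbij).
exact: pcard_eq g.
Qed.
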